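(* Let $f,g:\mathbb{R}^2\to\mathbb{R}$ be sufficiently smooth, let $(\tilde u,\tilde v)\in\mathbb{R}^2$ satisfy $f(\tilde u,\tilde v)=g(\tilde u,\tilde v)=0$, and let $$M=\begin{pmatrix} f_u & f_v\\ g_u & g_v\end{pmatrix}$$ be the matrix of first partial derivatives at $(\tilde u,\tilde v)$. Assume $\operatorname{tr}M<0$, $\det M>0$ and $f_u>0>g_v$. Then for every given $L>0$ there exist positive parameter values $(\alpha,D_u,D_v)=(\alpha^*,D_u^*,D_v^* )$ such that the linearization at the constant stationary solution $(u,v)=(\tilde u,\tilde v)$ of $$\partial_t u=D_u\,\partial_{xx}u+f(u,v),\qquad \partial_t v=\alpha\bigl(D_v\,\partial_{xx}v+g(u,v)\bigr),\qquad t>0,\ 0<x<L,$$ with the boundary conditions $\partial_x u=\partial_x v=0$ at $x=0,L$, has a pair of purely imaginary eigenvalues and a zero eigenvalue of multiplicity two. More precisely, at $(\alpha,D_u,D_v)=(\alpha^*,D_u^*,D_v^* )$ the matrix $M_{0,\alpha}$ has eigenvalues $\pm\mathrm{i}\omega$ for some $\omega>0$, each of the matrices $M_{1,\alpha}$ and $M_{2,\alpha}$ has the eigenvalue $0$, and all the other eigenvalues (the remaining eigenvalue of $M_{1,\alpha}$, the remaining eigenvalue of $M_{2,\alpha}$, and all eigenvalues of $M_{n,\alpha}$ for $n\ge 3$) are strictly negative.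
   Context: All partial derivatives $f_u,f_v,g_u,g_v$ are evaluated at $(\tilde u,\tilde v)$. For each integer $n\ge 0$, the matrix of the linearized operator on the Fourier cosine mode $\cos(n\pi x/L)$ is $$M_{n,\alpha}=\begin{pmatrix}-D_u\left(\frac{n\pi}{L}\right)^2+f_u & f_v\\ \alpha g_u & \alpha\left(-D_v\left(\frac{n\pi}{L}\right)^2+g_v\right)\end{pmatrix},$$ and the eigenvalues of the linearized operator are the eigenvalues of the matrices $M_{n,\alpha}$, $n\ge 0$. The parameters $\alpha$, $D_u$, $D_v$ are positive. *)

(* Defs.v *)
From HB Require Import structures.
From mathcomp Require Import all_boot all_order all_algebra.
From mathcomp Require Import all_classical all_reals all_analysis.
From mathcomp Require Import complex.

Set Implicit Arguments.
Unset Strict Implicit.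
Unset Printing Implicit Defensive.

Import Order.TTheory GRing.Theory Num.Theory.
Import numFieldNormedType.Exports.

#[global] Open Scope ring_scope.
#[global] Open Scope complex_scope.

Section Matrices.
Variable R : realType.

Definition mx22 (a b c d : R) : 'M[R]_2 :=
  \matrix_(i < 2, j < 2) nth 0 (nth [::] [:: [:: a; b]; [:: c; d]] i) j.

Definition col2 (a b : R) : 'cV[R]_2 := \col_(i < 2) nth 0 [:: a; b] i.

Definition cplx (A : 'M[R]_2) : 'M[R[i]]_2 := map_mx (real_complex R) A.

(* The complex eigenvalues of A, repeated according to their algebraic
   multiplicity, are exactly the entries of s. *)
Definition has_eigenvalues (A : 'M[R]_2) (s : seq R[i]) : Prop :=
  char_poly (cplx A) = \prod_(z <- s) ('X - z%:P).

End Matrices.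

Section Kinetics.
Variable R : realType.
Implicit Types (f g : R * R -> R) (p : R * R).

Definition partial_u f p : R := 'D_((1, 0) : R * R) f p.
Definition partial_v f p : R := 'D_((0, 1) : R * R) f p.

Definition C1_plane f : Prop :=
  [/\ forall p, differentiable f p,
      continuous (partial_u f) & continuous (partial_v f)].

Definition kinetics_mx f g p : 'M[R]_2 :=
  mx22 (partial_u f p) (partial_v f p) (partial_u g p) (partial_v g p).

Definition mode_mx f g p (L alpha Du Dv : R) (n : nat) : 'M[R]_2 :=
  mx22 (- Du * (n%:R * pi / L) ^+ 2 + partial_u f p)
       (partial_v f p)
       (alpha * partial_u g p)
       (alpha * (- Dv * (n%:R * pi / L) ^+ 2 + partial_v g p)).

End Kinetics.

Section Linearization.
Variable R : realType.
Implicit Types (f g : R * R -> R) (p : R * R) (z : R -> 'cV[R]_2)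
  (w : R -> 'cV[R[i]]_2).

Definition rd_rhs f g (alpha Du Dv : R) z (x : R) : 'cV[R]_2 :=
  col2 (Du * derive1n 2 (fun y => z y 0 0) x + f (z x 0 0, z x 1 0))
       (alpha * (Dv * derive1n 2 (fun y => z y 1 0) x
                 + g (z x 0 0, z x 1 0))).

(* Derivative at the constant state p of the right-hand side, in the
   direction z: d/de rhs(p + e z) at e = 0, pointwise in x. *)
Definition rd_lin f g (alpha Du Dv : R) p z (x : R) : 'cV[R]_2 :=
  \col_(i < 2) derive1
    (fun e : R =>
       rd_rhs f g alpha Du Dv (fun y => col2 p.1 p.2 + e *: z y) x i 0) 0.

Definition reals w : R -> 'cV[R]_2 := fun x => map_mx (@complex.Re R) (w x).
Definition imags w : R -> 'cV[R]_2 := fun x => map_mx (@complex.Im R) (w x).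

(* Complexification of the real linear operator rd_lin. *)
Definition rd_linC f g (alpha Du Dv : R) p w (x : R) : 'cV[R[i]]_2 :=
  \col_(i < 2) (rd_lin f g alpha Du Dv p (reals w) x i 0
                +i* rd_lin f g alpha Du Dv p (imags w) x i 0).

Definition C2_line (h : R -> R) : Prop :=
  [/\ forall x, derivable h x 1,
      forall x, derivable (derive1 h) x 1 & continuous (derive1n 2 h)].

Definition neumann (L : R) (h : R -> R) : Prop :=
  derive1 h 0 = 0 /\ derive1 h L = 0.

(* Functions of class C^2 on [0, L] are represented by C^2 functions on the
   whole line, so that derivatives at 0 and L are meaningful; two
   representatives are identified below when they agree on [0, L]. *)
Definition neumann_domain (L : R) w : Prop :=
  forall i : 'I_2,
    [/\ C2_line (fun x => reals w x i 0), C2_line (fun x => imags w x i 0),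
        neumann L (fun x => reals w x i 0)
      & neumann L (fun x => imags w x i 0)].

Definition eq_on (L : R) (w1 w2 : R -> 'cV[R[i]]_2) : Prop :=
  forall x : R, 0 <= x <= L -> w1 x = w2 x.

Definition lin_eigenvalue f g p (L alpha Du Dv : R) (lam : R[i]) : Prop :=
  exists w : R -> 'cV[R[i]]_2,
    [/\ neumann_domain L w, ~ eq_on L w (fun=> 0)
      & eq_on L (rd_linC f g alpha Du Dv p w) (fun x => lam *: w x)].

(* Kernel of (A - lam)^k, where A is the linearized operator with its
   domain: the iterates (A - lam)^j w, j < k, must lie in the domain. *)
Fixpoint gen_eigenfun f g p (L alpha Du Dv : R) (lam : R[i]) (k : nat) w :
    Prop :=
  if k is k'.+1 then
    neumann_domain L w /\
    exists w' : R -> 'cV[R[i]]_2,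
      eq_on L (rd_linC f g alpha Du Dv p w) (fun x => lam *: w x + w' x) /\
      gen_eigenfun f g p L alpha Du Dv lam k' w'
  else eq_on L w (fun=> 0).

(* The algebraic multiplicity of lam, i.e. the complex dimension of its
   generalized eigenspace, equals m. *)
Definition lin_multiplicity f g p (L alpha Du Dv : R) (lam : R[i]) (m : nat) :
    Prop :=
  exists e : 'I_m -> R -> 'cV[R[i]]_2,
    [/\ forall i, exists k, gen_eigenfun f g p L alpha Du Dv lam k (e i),
        forall c : 'I_m -> R[i],
          eq_on L (fun x => \sum_(i < m) c i *: e i x) (fun=> 0) ->
          forall i, c i = 0
      & forall (k : nat) (w : R -> 'cV[R[i]]_2),
          gen_eigenfun f g p L alpha Du Dv lam k w ->
          exists c : 'I_m -> R[i],
            eq_on L w (fun x => \sum_(i < m) c i *: e i x)].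

End Linearization.

(* Main.v *)
Require Import Defs.
From mathcomp Require Import all_boot all_order all_algebra.
From mathcomp Require Import all_classical all_reals all_analysis.
From mathcomp Require Import complex.
From mathcomp Require Import ring lra.
Import Order.TTheory GRing.Theory Num.Theory.
Import numFieldNormedType.Exports.

(* With q = (pi / L)^2, alpha = - f_u / g_v makes M_0 trace-free, and
   a = D_u q, b = D_v q are chosen so that
   det M_n = alpha a b (n^2 - 1) (n^2 - 4), i.e. 4 a b = det M and
   f_u b + g_v a = 5 a b; this reduces to a quadratic equation for a.  For
   n >= 1 the trace of M_n is - n^2 (a + alpha b) < 0, and for n >= 3 the
   eigenvalues are real because
   tr^2 - 4 det = n^4 (a - alpha b)^2 + 4 alpha a b (5 n^2 - 4).

   The algebraic multiplicity of 0 needs no Fourier expansion.  Pairing a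
   solution of A w = c_1 e_1 + c_2 e_2 with the left null vectors of M_1 and
   M_2 gives two scalar forced oscillators; the Neumann conditions rule out
   resonant forcing, so c_1 = c_2 = 0 (there are no generalized
   eigenfunctions), and the free oscillators are multiples of cosines. *)

Set Implicit Arguments.
Unset Strict Implicit.

(** * Scalar oscillators on an interval with Neumann conditions *)

Section Oscillator.
Variable R : realType.
Implicit Types (L p r s x A B : R) (y h F : R -> R).

(* Unlike [is_derive], not a class: premises stay visible subgoals. *)
Definition has_derivative h x d : Prop := is_derive x 1 h d.

Lemma has_derivative_eq h x d d' :
  has_derivative h x d -> d = d' -> has_derivative h x d'.
Proof. by move=> ? <-. Qed.

Lemma has_derivative_mul h k x d d' :
  has_derivative h x d -> has_derivative k x d' ->
  has_derivative (fun t => h t * k t) x (d * k x + h x * d').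
Proof.
move=> H K; rewrite addrC (mulrC d); exact: is_deriveM H K.
Qed.

Lemma has_derivative_add h k x d d' :
  has_derivative h x d -> has_derivative k x d' ->
  has_derivative (fun t => h t + k t) x (d + d').
Proof. by move=> H K; exact: (is_deriveD H K). Qed.

Lemma has_derivative_scal (c : R) h x d :
  has_derivative h x d -> has_derivative (fun t => c * h t) x (c * d).
Proof. by move=> H; exact: (is_deriveZ c H). Qed.

Lemma has_derivative_lin p x : has_derivative (fun t => p * t) x p.
Proof.
by apply: has_derivative_eq; [exact/has_derivative_scal/is_derive_id|
  rewrite mulr1].
Qed.

Lemma has_derivative_cosZ p x :
  has_derivative (fun t => cos (p * t)) x (- p * sin (p * x)).
Proof.
apply: has_derivative_eq.
  exact: (is_derive1_comp (is_derive_cos (p * x)) (has_derivative_lin p x)).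
by ring.
Qed.

Lemma has_derivative_sinZ p x :
  has_derivative (fun t => sin (p * t)) x (p * cos (p * x)).
Proof.
apply: has_derivative_eq.
  exact: (is_derive1_comp (is_derive_sin (p * x)) (has_derivative_lin p x)).
by ring.
Qed.

Lemma C2_line_has_derivative h : C2_line h -> forall x,
  has_derivative h x (derive1 h x) /\
  has_derivative (derive1 h) x (derive1n 2 h x).
Proof.
move=> [d1 d2 _] x; split; rewrite ?/derive1n /= derive1E; exact: derivableP.
Qed.

Lemma derive0_constant L F :
  (forall x, 0 <= x <= L -> has_derivative F x 0) ->
  forall x, 0 <= x <= L -> F x = F 0.
Proof.
move=> dF x /andP[x0 xL].
have [y yx] : exists2 y, y \in `[0, x] & F x - F 0 = 0 * (x - 0).
  apply: (@MVT_segment _ _ (fun=> 0)) => //.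
    by move=> y; rewrite in_itv /= => /andP[y0 yx]; apply: dF; lra.
  apply: derivable_within_continuous => y; rewrite in_itv /= => /andP[y0 yx].
  by apply: ex_derive; apply: dF; lra.
by rewrite mul0r => /eqP; rewrite subr_eq0 => /eqP.
Qed.

(** In the phase plane with coordinates [derive1 y] and [p * y] the free oscillator is a rotation.
    [P] and [Q] are the coordinates in the frame rotating with it, so they are constant; rotating
    back recovers [y]. *)
Lemma oscillator_cos L p y :
  p != 0 -> C2_line y -> derive1 y 0 = 0 ->
  (forall x, 0 <= x <= L -> derive1n 2 y x + p ^+ 2 * y x = 0) ->
  forall x, 0 <= x <= L -> y x = y 0 * cos (p * x).
Proof.
move=> p0 Cy y'0 ode x xL.
have L0 : 0 <= L by lra.
pose P t := derive1 y t * sin (p * t) + (- p * y t) * cos (p * t).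
pose Q t := derive1 y t * cos (p * t) + (p * y t) * sin (p * t).
have PE : P x = P 0.
  apply: (@derive0_constant L P) => // t tL.
  have [d1 d2] := C2_line_has_derivative Cy t.
  apply: has_derivative_eq.
    apply: has_derivative_add; apply: has_derivative_mul;
      [exact: d2|exact: has_derivative_sinZ|
       exact/has_derivative_scal/d1|exact: has_derivative_cosZ].
  have /eqP := ode _ tL; rewrite addr_eq0 => /eqP ->; ring.
have QE : Q x = Q 0.
  apply: (@derive0_constant L Q) => // t tL.
  have [d1 d2] := C2_line_has_derivative Cy t.
  apply: has_derivative_eq.
    apply: has_derivative_add; apply: has_derivative_mul;
      [exact: d2|exact: has_derivative_cosZ|
       exact/has_derivative_scal/d1|exact: has_derivative_sinZ].
  have /eqP := ode _ tL; rewrite addr_eq0 => /eqP ->; ring.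
move: PE QE; rewrite /P /Q y'0 !mulr0 cos0 sin0 => PE QE.
apply: (mulfI p0); have cs := cos2Dsin2 (p * x).
transitivity (p * y x * (cos (p * x) ^+ 2 + sin (p * x) ^+ 2)).
  by rewrite cs mulr1.
transitivity (- cos (p * x) * (derive1 y x * sin (p * x) + - p * y x * cos (p * x))
  + sin (p * x) * (derive1 y x * cos (p * x) + p * y x * sin (p * x))).
  by ring.
by rewrite PE QE; ring.
Qed.

(** Multiply the equation by [cos (p * x)] and integrate over the interval. The left side gives
    boundary terms, which vanish by the Neumann conditions and [sin (p * L) = 0]; the [B] term
    integrates to 0 because the frequencies differ; what remains is [A * L / 2 = 0]. *)
Lemma oscillator_resonance L p r y A B :
  0 < L -> p != 0 -> p ^+ 2 != r ^+ 2 ->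
  sin (p * L) = 0 -> sin (r * L) = 0 ->
  C2_line y -> neumann L y ->
  (forall x, 0 <= x <= L ->
     derive1n 2 y x + p ^+ 2 * y x = A * cos (p * x) + B * cos (r * x)) ->
  A = 0.
Proof.
move=> L0 p0 pr sp sr Cy [y'0 y'L] ode.
have pr0 : p ^+ 2 - r ^+ 2 != 0 by rewrite subr_eq0.
(* An explicit antiderivative of [cos (p * t)] times left side minus right side. The first two terms
   come from integrating by parts, the others from the primitives of cos^2 and of a product of two
   cosines. The factors [1 *] and [(- r) *] fit the shapes of the [has_derivative] rules. *)
pose F t := derive1 y t * cos (p * t) + (p * y t) * sin (p * t)
  + ((- A / 2) * (1 * t + p^-1 * (sin (p * t) * cos (p * t)))
   + (- B / (p ^+ 2 - r ^+ 2)) * (p * (sin (p * t) * cos (r * t))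
                                + (- r) * (cos (p * t) * sin (r * t)))).
have FE : F L = F 0.
  apply: (@derive0_constant L F); last by lra.
  move=> t tL; have [d1 d2] := C2_line_has_derivative Cy t.
  apply: has_derivative_eq.
    apply: has_derivative_add; first apply: has_derivative_add;
      first apply: has_derivative_mul;
      first exact: d2.
    - exact: has_derivative_cosZ.
    - apply: has_derivative_mul;
        [exact/has_derivative_scal/d1|exact: has_derivative_sinZ].
    - apply: has_derivative_add; apply/has_derivative_scal/has_derivative_add.
      + exact: has_derivative_lin.
      + apply/has_derivative_scal/has_derivative_mul;
          [exact: has_derivative_sinZ|exact: has_derivative_cosZ].
      + apply/has_derivative_scal/has_derivative_mul;
          [exact: has_derivative_sinZ|exact: has_derivative_cosZ].
      + apply/has_derivative_scal/has_derivative_mul;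
          [exact: has_derivative_cosZ|exact: has_derivative_sinZ].
  have -> : derive1n 2 y t
      = A * cos (p * t) + B * cos (r * t) - p ^+ 2 * y t.
    by rewrite -(ode _ tL) addrK.
  (* The terms in [y] and [B] cancel identically; the [A] terms cancel only through cos^2 + sin^2 =
     1, applied next. *)
  transitivity (A * ((cos (p * t)) ^+ 2
    - (1 + (cos (p * t) ^+ 2 - sin (p * t) ^+ 2)) / 2)).
    by field; rewrite pr0.
  by rewrite -{1}(cos2Dsin2 (p * t)); field.
move: FE; rewrite /F y'0 y'L sp sr !mulr0 sin0 !mul0r !mulr0 !(addr0, add0r).
rewrite !mulr0 !addr0 => /eqP; rewrite mulf_eq0 mul1r (gt_eqF L0) orbF.
rewrite mulf_eq0 invr_eq0 pnatr_eq0 orbF.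
by rewrite oppr_eq0 => /eqP.
Qed.

End Oscillator.

(** * The linearized operator and its action on cosine modes *)

Section Linearization.
Variable R : realType.
Implicit Types (f g : R * R -> R) (p : R * R) (z : R -> 'cV[R]_2).

(** The difference quotient at 0 is the one defining ['D_(a, b) f p], and the differential is linear
    in the direction. *)
Lemma has_derivative_line f p (a b : R) : differentiable f p ->
  has_derivative (fun e => f (p.1 + e * a, p.2 + e * b)) 0
    (partial_u f p * a + partial_v f p * b).
Proof.
move=> df.
pose F e := f (p.1 + e * a, p.2 + e * b).
have E : (fun h : R => h^-1 *: (F (h *: 1 + 0) - F 0))
       = (fun h : R => h^-1 *: (f (h *: (a, b) + p) - f p)).
  apply/funext => h; rewrite /F /GRing.scale /= addr0 mulr1 !mul0r !addr0.
  by rewrite (addrC p.1) (addrC p.2); case: p {df F}.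
have D : 'D_(a, b) f p = partial_u f p * a + partial_v f p * b.
  rewrite /partial_u /partial_v !deriveE //.
  have -> : (a, b) = a *: ((1, 0) : R * R) + b *: ((0, 1) : R * R).
    by apply: injective_projections => /=;
      rewrite scaler0 ?addr0 ?add0r /GRing.scale /= mulr1.
  by rewrite linearD !linearZ /= /GRing.scale /= mulrC (mulrC b).
split; first by rewrite /derivable E; exact: diff_derivable.
by rewrite -D /derive E.
Qed.

Lemma derive12_affine (c e : R) (h : R -> R) : C2_line h ->
  derive1n 2 (fun y => c + e * h y) = fun y => e * derive1n 2 h y.
Proof.
move=> Ch.
have E : derive1 (fun y => c + e * h y) = fun y => e * derive1 h y.
  apply/funext => x; have [d1 _] := C2_line_has_derivative Ch x.
  have [_ D] := has_derivative_add (is_derive_cst c x 1)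
    (has_derivative_scal e d1).
  by rewrite derive1E D add0r.
apply/funext => x; have [_ d2] := C2_line_has_derivative Ch x.
have [_ D] := has_derivative_scal e d2.
by rewrite /derive1n /= E derive1E D.
Qed.

(** The constant state has zero second derivative, so the diffusion terms are linear in [e]; only
    the kinetics call for the differential of [f] and [g]. *)
Lemma rd_linE f g (alpha Du Dv : R) p z x :
  differentiable f p -> differentiable g p ->
  (forall i, C2_line (fun y => z y i 0)) ->
  rd_lin f g alpha Du Dv p z x =
  col2 (Du * derive1n 2 (fun y => z y 0 0) x
          + (partial_u f p * z x 0 0 + partial_v f p * z x 1 0))
       (alpha * (Dv * derive1n 2 (fun y => z y 1 0) x
          + (partial_u g p * z x 0 0 + partial_v g p * z x 1 0))).
Proof.
move=> df dg Cz.
have E e i : (fun y => (col2 p.1 p.2 + e *: z y) i 0)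
           = fun y => col2 p.1 p.2 i 0 + e * z y i 0.
  by apply/funext => y; rewrite !mxE.
have Ed e i : derive1n 2 (fun y => (col2 p.1 p.2 + e *: z y) i 0) x
            = derive1n 2 (fun y => z y i 0) x * e.
  by rewrite E derive12_affine // mulrC.
apply/colP => i; rewrite !mxE derive1E.
have -> : (fun e => rd_rhs f g alpha Du Dv
             (fun y => col2 p.1 p.2 + e *: z y) x i 0)
  = (fun e => nth 0 [::
       Du * (derive1n 2 (fun y => z y 0 0) x * e)
         + f (p.1 + e * z x 0 0, p.2 + e * z x 1 0);
       alpha * (Dv * (derive1n 2 (fun y => z y 1 0) x * e)
         + g (p.1 + e * z x 0 0, p.2 + e * z x 1 0))] i).
  by apply/funext => e; rewrite !mxE !Ed.
case: i => -[|[|//]] /= _.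
- have [_ ->] := has_derivative_add
    (has_derivative_scal Du
      (has_derivative_lin (derive1n 2 (fun y => z y 0 0) x) 0))
    (has_derivative_line (z x 0 0) (z x 1 0) df).
  by [].
- have [_ ->] := has_derivative_scal alpha (has_derivative_add
    (has_derivative_scal Dv
      (has_derivative_lin (derive1n 2 (fun y => z y 1 0) x) 0))
    (has_derivative_line (z x 0 0) (z x 1 0) dg)).
  by [].
Qed.

Lemma derive1_cos (c k : R) :
  derive1 (fun x => c * cos (k * x)) = fun x => c * - k * sin (k * x).
Proof.
apply/funext => x; rewrite derive1E.
have [_ ->] := has_derivative_scal c (has_derivative_cosZ k x).
by rewrite mulrA.
Qed.

Lemma derive12_cos (c k : R) :
  derive1n 2 (fun x => c * cos (k * x)) = fun x => - k ^+ 2 * c * cos (k * x).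
Proof.
apply/funext => x; rewrite derive1nS derive1n1 derive1_cos derive1E.
have [_ ->] := has_derivative_scal (c * - k) (has_derivative_sinZ k x).
by ring.
Qed.

Lemma C2_line_cos (c k : R) : C2_line (fun x => c * cos (k * x)).
Proof.
split=> [x|x|].
- by have [] := has_derivative_scal c (has_derivative_cosZ k x).
- rewrite derive1_cos.
  by have [] := has_derivative_scal (c * - k) (has_derivative_sinZ k x).
- rewrite derive12_cos => x.
  apply: differentiable_continuous; apply/derivable1_diffP.
  by have [] := has_derivative_scal (- k ^+ 2 * c) (has_derivative_cosZ k x).
Qed.

Lemma neumann_cos (L c k : R) : sin (k * L) = 0 ->
  neumann L (fun x => c * cos (k * x)).
Proof.
move=> skL; split; rewrite derive1E.
  have [_ ->] := has_derivative_scal c (has_derivative_cosZ k 0).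
  by rewrite mulr0 sin0 !mulr0.
have [_ ->] := has_derivative_scal c (has_derivative_cosZ k L).
by rewrite skL !mulr0.
Qed.

Definition cos_mode (k : R) (v : 'cV[R[i]]_2) (x : R) : 'cV[R[i]]_2 :=
  (cos (k * x))%:C *: v.

Lemma reals_cos_mode k v i :
  (fun x => reals (cos_mode k v) x i 0)
  = fun x => complex.Re (v i 0) * cos (k * x).
Proof.
by apply/funext => x; rewrite !mxE; case: (v i 0) => a b /=; ring.
Qed.

Lemma imags_cos_mode k v i :
  (fun x => imags (cos_mode k v) x i 0)
  = fun x => complex.Im (v i 0) * cos (k * x).
Proof.
by apply/funext => x; rewrite !mxE; case: (v i 0) => a b /=; ring.
Qed.

Lemma neumann_domain_cos_mode (L k : R) v : sin (k * L) = 0 ->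
  neumann_domain L (cos_mode k v).
Proof.
move=> skL i; rewrite reals_cos_mode imags_cos_mode.
by split; [exact: C2_line_cos|exact: C2_line_cos|exact: neumann_cos..].
Qed.

(** Cosines are eigenfunctions of the second derivative, so each mode is invariant and the operator
    acts on its amplitude by the mode matrix. This carries null vectors and eigenvectors of matrices
    over to functions. *)
Lemma rd_linC_cos_mode f g (L alpha Du Dv : R) p n v x :
  differentiable f p -> differentiable g p ->
  rd_linC f g alpha Du Dv p (cos_mode (n%:R * pi / L) v) x
  = cos_mode (n%:R * pi / L) (cplx (mode_mx f g p L alpha Du Dv n) *m v) x.
Proof.
move=> df dg; set k := n%:R * pi / L.
have Er i y : reals (cos_mode k v) y i 0 = complex.Re (v i 0) * cos (k * y).
  by move: (reals_cos_mode k v i) => /(congr1 (fun h => h y)).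
have Ei i y : imags (cos_mode k v) y i 0 = complex.Im (v i 0) * cos (k * y).
  by move: (imags_cos_mode k v i) => /(congr1 (fun h => h y)).
apply/colP => i; rewrite mxE !rd_linE //.
- rewrite !reals_cos_mode !imags_cos_mode !derive12_cos !Er !Ei.
  rewrite !mxE !big_ord_recl big_ord0 !mxE /=.
  have -> : lift ord0 ord0 = 1 :> 'I_2 by exact/val_inj.
  case: (v 0 0) => a b; case: (v 1 0) => c d /=.
  case: i => -[|[|//]] /= _; apply/eqP; rewrite eq_complex /=;
    apply/andP; split; apply/eqP; rewrite -/k; ring.
- by move=> j; rewrite imags_cos_mode; exact: C2_line_cos.
- by move=> j; rewrite reals_cos_mode; exact: C2_line_cos.
Qed.

Lemma sin_mode (L : R) n : 0 < L -> sin (n%:R * pi / L * L) = 0.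
Proof.
move=> L0; rewrite divfK ?gt_eqF // mulr_natl.
elim: n => [|n IH]; first by rewrite mulr0n sin0.
by rewrite mulrSr sinDpi IH oppr0.
Qed.

Lemma cos_mode_eigenvalue f g (L alpha Du Dv : R) p n (v : 'cV[R[i]]_2)
    (lam : R[i]) : 0 < L ->
  differentiable f p -> differentiable g p -> v != 0 ->
  cplx (mode_mx f g p L alpha Du Dv n) *m v = lam *: v ->
  lin_eigenvalue f g p L alpha Du Dv lam.
Proof.
move=> L0 df dg v0 Mv; exists (cos_mode (n%:R * pi / L) v); split.
- exact/neumann_domain_cos_mode/sin_mode.
(* At [x = 0] the cosine is 1, so the mode takes the nonzero value [v] there. *)
- move=> /(_ 0); rewrite lexx (ltW L0) => /(_ isT) /eqP.
  by rewrite /cos_mode mulr0 cos0 scale1r (negPf v0).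
- move=> x _; rewrite rd_linC_cos_mode // Mv /cos_mode.
  by rewrite !scalerA mulrC.
Qed.

Lemma derive1_comb (c d : R) (h k : R -> R) : C2_line h -> C2_line k ->
  derive1 (fun x => c * h x + d * k x)
  = (fun x => c * derive1 h x + d * derive1 k x).
Proof.
move=> Ch Ck; apply/funext => x.
have [h1 _] := C2_line_has_derivative Ch x.
have [k1 _] := C2_line_has_derivative Ck x.
have [_ D] := has_derivative_add
  (has_derivative_scal c h1) (has_derivative_scal d k1).
by rewrite derive1E D.
Qed.

Lemma derive12_comb (c d : R) (h k : R -> R) : C2_line h -> C2_line k ->
  derive1n 2 (fun x => c * h x + d * k x)
  = (fun x => c * derive1n 2 h x + d * derive1n 2 k x).
Proof.
move=> Ch Ck; apply/funext => x.
have [_ h1] := C2_line_has_derivative Ch x.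
have [_ k1] := C2_line_has_derivative Ck x.
have [_ D] := has_derivative_add
  (has_derivative_scal c h1) (has_derivative_scal d k1).
by rewrite derive1nS derive1n1 (derive1_comb _ _ Ch Ck) derive1E D.
Qed.

Lemma C2_line_comb (c d : R) (h k : R -> R) : C2_line h -> C2_line k ->
  C2_line (fun x => c * h x + d * k x).
Proof.
move=> Ch Ck; split=> [x|x|].
- have [h1 _] := C2_line_has_derivative Ch x.
  have [k1 _] := C2_line_has_derivative Ck x.
  by have [] := has_derivative_add (has_derivative_scal c h1)
                  (has_derivative_scal d k1).
- have [_ h2] := C2_line_has_derivative Ch x.
  have [_ k2] := C2_line_has_derivative Ck x.
  rewrite derive1_comb //.
  by have [] := has_derivative_add (has_derivative_scal c h2)
                  (has_derivative_scal d k2).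
- rewrite derive12_comb // => x.
  case: Ch Ck => _ _ Ch [_ _ Ck].
  apply: (@continuousD _ R R (fun x => c * derive1n 2 h x)
                             (fun x => d * derive1n 2 k x) x).
    by apply: (@continuousM _ R (fun=> c)); [exact: cst_continuous|exact: Ch].
  by apply: (@continuousM _ R (fun=> d)); [exact: cst_continuous|exact: Ck].
Qed.

End Linearization.

(** * Choice of the diffusion parameters *)

Section Kernel.
Variable R : realType.

(** Substituting b = d / (4 a) turns the last equation into - gv a^2 + (5/4) d a - d fu / 4 = 0. Its
    leading coefficient is positive and its constant term negative, so it has a positive root; [S]
    is the square root of its discriminant. *)
Lemma turing_parameters (fu gv d : R) : 0 < fu -> gv < 0 -> 0 < d ->
  exists a b : R,
    [/\ 0 < a, 0 < b, 4 * a * b = d & fu * b + gv * a = 5 * a * b].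
Proof.
move=> fu0 gv0 d0.
pose S := Num.sqrt ((5 / 4 * d) ^+ 2 - gv * d * fu).
have gdf : 0 < - (gv * d * fu) by rewrite -!mulNr !mulr_gt0 // oppr_gt0.
have S2 : S ^+ 2 = (5 / 4 * d) ^+ 2 - gv * d * fu.
  by rewrite sqr_sqrtr // addr_ge0 ?sqr_ge0 // ltW.
have S0 : 5 / 4 * d < S.
  by rewrite -(@ltr_pXn2r _ 2) ?nnegrE ?sqrtr_ge0 //; [rewrite S2; lra|lra].
pose a := (S - 5 / 4 * d) / (- 2 * gv).
have a0 : 0 < a by rewrite divr_gt0 // ?subr_gt0 //; lra.
exists a, (d / (4 * a)); split=> //.
- by rewrite divr_gt0 // mulr_gt0.
- by field; rewrite gt_eqF.
have gvn : gv != 0 by rewrite lt_eqF.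
have an : a != 0 by rewrite gt_eqF.
have E : - gv * a ^+ 2 + 5 / 4 * d * a = d * fu / 4.
  have -> : d * fu / 4 = (S ^+ 2 - (5 / 4 * d) ^+ 2) / (- 4 * gv).
    by rewrite S2; field.
  by rewrite /a; field.
apply: (mulIf an); transitivity (d * fu / 4 + gv * a ^+ 2); first by field.
by rewrite -E; field.
Qed.

(** * Critical modes and the kernel equation in real form *)

Variables (fu fv gu gv alpha a b : R).
Hypotheses (alpha0 : 0 < alpha) (a0 : 0 < a) (b0 : 0 < b).
Hypothesis detE : 4 * a * b = fu * gv - fv * gu.
Hypothesis critE : fu * b + gv * a = 5 * a * b.
Hypothesis traceE : fu + alpha * gv = 0.
Hypothesis fvgu : fv * gu < 0.

(** Here [m] stands for n^2. The left side is quadratic in [m], and [detE] and [critE] make its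
    coefficients those of a b (m^2 - 5 m + 4). *)
Lemma mode_det (m : R) :
  (fu - m * a) * (gv - m * b) - fv * gu = a * b * (m - 1) * (m - 4).
Proof.
transitivity (fu * gv - fv * gu - m * (fu * b + gv * a) + m ^+ 2 * a * b).
  by ring.
by rewrite critE -detE; ring.
Qed.

Section Critical.
Variable m : R.
Hypothesis m0 : 0 < m.
Hypothesis mcrit : (fu - m * a) * (gv - m * b) = fv * gu.

(** Otherwise the product in [mcrit] would vanish, against [fv * gu < 0]. *)
Lemma critical_neq0 : m * a - fu != 0.
Proof.
apply/eqP => H; move: fvgu; rewrite -mcrit.
by rewrite (_ : fu - m * a = 0) ?mul0r ?ltxx // -[LHS]opprK opprB H oppr0.
Qed.

(* The pairing of the left and right null vectors of the mode matrix; it is a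
   nonzero multiple of the trace, which is what makes 0 a simple eigenvalue. *)
Lemma critical_pairing : gu * fv + (m * a - fu) ^+ 2 / alpha != 0.
Proof.
have an : alpha != 0 by rewrite gt_eqF.
rewrite [gu * fv]mulrC -mcrit.
(* The last factor is minus the trace of the mode matrix; [traceE] reduces it to m (a + alpha b). *)
have -> : (fu - m * a) * (gv - m * b) + (m * a - fu) ^+ 2 / alpha
  = (m * a - fu) / alpha * (m * a + alpha * (m * b) - (fu + alpha * gv)).
  by field.
rewrite traceE subr0 mulf_neq0 ?mulf_neq0 ?invr_eq0 ?critical_neq0 //.
by rewrite gt_eqF // addr_gt0 ?mulr_gt0.
Qed.

End Critical.

Variables (L s Du Dv : R).
Hypotheses (L0 : 0 < L) (s0 : s != 0) (sL : sin (s * L) = 0).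
Hypothesis s2L : sin (2 * s * L) = 0.
Hypotheses (aE : a = Du * s ^+ 2) (bE : b = Dv * s ^+ 2).

(** The critical values of [m] are 1 and 4, the squares of the mode numbers 1 and 2. *)
Let crit1 : (fu - 1 * a) * (gv - 1 * b) = fv * gu.
Proof. by apply/eqP; rewrite -subr_eq0 mode_det; apply/eqP; ring. Qed.

Let crit4 : (fu - 4 * a) * (gv - 4 * b) = fv * gu.
Proof. by apply/eqP; rewrite -subr_eq0 mode_det; apply/eqP; ring. Qed.

Variables (u v : R -> R).
Hypotheses (Cu : C2_line u) (Cv : C2_line v).
Hypotheses (Nu : neumann L u) (Nv : neumann L v).

Let y (m : R) x := gu * Du * u x + (m * a - fu) * Dv * v x.

Let Cy m : C2_line (y m).
Proof. exact: C2_line_comb. Qed.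

Let Ny m : neumann L (y m).
Proof.
case: Nu Nv => [u0 uL] [v0 vL].
by split; rewrite /y derive1_comb // ?u0 ?v0 ?uL ?vL !mulr0 addr0.
Qed.

(* [y m] is the pairing of the system with the left null vector
   [(gu, m * a - fu)] of the critical mode matrix. *)
Let y_ode m x E1 E2 : (fu - m * a) * (gv - m * b) = fv * gu ->
  Du * derive1n 2 u x + (fu * u x + fv * v x) = E1 ->
  alpha * (Dv * derive1n 2 v x + (gu * u x + gv * v x)) = E2 ->
  derive1n 2 (y m) x + m * s ^+ 2 * y m x = gu * E1 + (m * a - fu) * E2 / alpha.
Proof.
have an : alpha != 0 by rewrite gt_eqF.
move=> mc <- <-; rewrite /y derive12_comb //; apply/eqP; rewrite -subr_eq0.
(* The terms in [u] cancel for every [m]; the coefficient of [v] vanishes by criticality. *)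
apply/eqP; transitivity (((fu - m * a) * (gv - m * b) - fv * gu) * v x).
  move: (derive1n 2 u x) (derive1n 2 v x) (u x) (v x) => u2 v2 u0 v0.
  by rewrite aE bE; field.
by rewrite mc subrr mul0r.
Qed.

(** The right side is a combination of the two null modes, with amplitudes [(fv, a - fu)] and
    [(fv, 4 * a - fu)]. One statement thus covers both the kernel (zero right side) and the step
    from one generalized eigenfunction to the next. *)
Lemma critical_solution (c1 c2 : R) :
  (forall x, 0 <= x <= L ->
     Du * derive1n 2 u x + (fu * u x + fv * v x)
     = fv * (c1 * cos (s * x) + c2 * cos (2 * s * x)) /\
     alpha * (Dv * derive1n 2 v x + (gu * u x + gv * v x))
     = (a - fu) * (c1 * cos (s * x)) + (4 * a - fu) * (c2 * cos (2 * s * x))) ->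
  exists d1 d2 : R, forall x, 0 <= x <= L ->
    u x = fv * (d1 * cos (s * x) + d2 * cos (2 * s * x)) /\
    v x = (a - fu) * (d1 * cos (s * x)) + (4 * a - fu) * (d2 * cos (2 * s * x)).
Proof.
move=> ode.
have an : alpha != 0 by rewrite gt_eqF.
have s2n : 2 * s != 0 by rewrite mulf_neq0.
have s2 : s ^+ 2 != (2 * s) ^+ 2.
  rewrite -subr_eq0 (_ : _ - _ = - 3 * s ^+ 2); last by ring.
  by rewrite mulf_neq0 ?expf_neq0 // lt_eqF //; lra.
have n1 := critical_neq0 crit1; have n4 := critical_neq0 crit4.
have p1 := critical_pairing ltr01 crit1.
have p4 := critical_pairing (ltr0Sn _ 3) crit4.
(* In the equation for [y 1] the forcing at the resonant frequency [s] has amplitude [c1] times the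
   nonzero pairing; the [c2] forcing is off resonance. For [y 4] the two frequencies exchange
   roles. *)
have c10 : c1 = 0.
  suff : c1 * (gu * fv + (1 * a - fu) ^+ 2 / alpha) = 0.
    by move/eqP; rewrite mulf_eq0 (negPf p1) orbF => /eqP.
  apply: (@oscillator_resonance _ L s (2 * s) (y 1) _
     (c2 * (gu * fv + (1 * a - fu) * (4 * a - fu) / alpha))
     L0 s0 s2 sL s2L (Cy 1) (Ny 1)).
  move=> x xL; have [e1 e2] := ode x xL.
  have := y_ode crit1 e1 e2; rewrite mul1r => ->; field.
  exact: an.
have c20 : c2 = 0.
  suff : c2 * (gu * fv + (4 * a - fu) ^+ 2 / alpha) = 0.
    by move/eqP; rewrite mulf_eq0 (negPf p4) orbF => /eqP.
  rewrite eq_sym in s2.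
  apply: (@oscillator_resonance _ L (2 * s) s (y 4) _
     (c1 * (gu * fv + (1 * a - fu) * (4 * a - fu) / alpha))
     L0 s2n s2 s2L sL (Cy 4) (Ny 4)).
  move=> x xL; have [e1 e2] := ode x xL.
  have := y_ode crit4 e1 e2.
  rewrite (_ : (2 * s) ^+ 2 = 4 * s ^+ 2); last by ring.
  by move=> ->; field.
have y1E x : 0 <= x <= L -> y 1 x = y 1 0 * cos (s * x).
  apply: (oscillator_cos s0 (Cy 1) (proj1 (Ny 1))) => t tL.
  have [e1 e2] := ode t tL.
  have := y_ode crit1 e1 e2; rewrite mul1r => ->.
  by rewrite c10 c20; field.
have y4E x : 0 <= x <= L -> y 4 x = y 4 0 * cos (2 * s * x).
  apply: (oscillator_cos s2n (Cy 4) (proj1 (Ny 4))) => t tL.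
  have [e1 e2] := ode t tL.
  have := y_ode crit4 e1 e2.
  rewrite (_ : (2 * s) ^+ 2 = 4 * s ^+ 2); last by ring.
  by move=> ->; rewrite c10 c20; field.
have s2n0 : s ^+ 2 != 0 by rewrite expf_neq0.
have Du0 : Du != 0 by apply: contraTneq a0 => D0; rewrite aE D0 mul0r ltxx.
have Dv0 : Dv != 0 by apply: contraTneq b0 => D0; rewrite bE D0 mul0r ltxx.
have gu0 : gu != 0 by apply: contraTneq fvgu => ->; rewrite mulr0 ltxx.
(* Orthogonality, with weights [Du] and [Dv], of the left null vector of one critical mode to the
   right null vector of the other; it rests on [critE]. *)
have key : Du * (fv * gu) = - Dv * ((4 * a - fu) * (1 * a - fu)).
  apply: (mulIf s2n0); rewrite mulrAC -aE -crit1.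
  transitivity (- b * ((4 * a - fu) * (1 * a - fu))); last by rewrite bE; ring.
  apply/eqP; rewrite -subr_eq0; apply/eqP.
  transitivity ((fu - a) * ((fu * b + gv * a) - 5 * a * b)); first by ring.
  by rewrite critE subrr mulr0.
have an0 : a != 0 by rewrite gt_eqF.
(* The definitions of [y 1] and [y 4] form a linear system for [u] and [v], solved in [vE] and [uE].
   The witnesses are read off by comparing [vE] with the claimed form of [v]; [key] makes them fit
   [u] as well. *)
exists (- y 1 0 / (3 * a * Dv * (1 * a - fu))),
  (y 4 0 / (3 * a * Dv * (4 * a - fu))).
move=> x xL.
have vE : 3 * a * Dv * v x = y 4 x - y 1 x by rewrite /y; ring.
have uE : 3 * a * gu * Du * u x = (4 * a - fu) * y 1 x - (1 * a - fu) * y 4 x.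
  by rewrite /y; ring.
have n1' : a - fu != 0 by rewrite -(mul1r a).
have three : (3 : R) != 0 by rewrite pnatr_eq0.
move: vE uE; rewrite y1E // y4E // => vE uE; split; last first.
  have h : 3 * a * Dv != 0 by rewrite !mulf_neq0.
  apply: (mulfI h); rewrite vE; field.
  by rewrite n4 Dv0 an0 n1'.
have h : 3 * a * gu * Du != 0 by rewrite !mulf_neq0.
apply: (mulfI h); rewrite uE.
transitivity (3 * a * (Du * (fv * gu)) *
  (- y 1 0 / (3 * a * Dv * (1 * a - fu)) * cos (s * x) +
   y 4 0 / (3 * a * Dv * (4 * a - fu)) * cos (2 * s * x))); last by ring.
rewrite key; field.
by rewrite n4 Dv0 an0 n1'.
Qed.
End Kernel.

(** * Eigenvalues of 2 by 2 matrices *)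

Lemma det_mx2 (F : comNzRingType) (A : 'M[F]_2) :
  \det A = A 0 0 * A 1 1 - A 0 1 * A 1 0.
Proof.
have e1 : lift 0 0 = 1 :> 'I_2 by exact/val_inj.
have e0 : lift 1 0 = 0 :> 'I_2 by exact/val_inj.
rewrite (expand_det_row _ 0) !big_ord_recl big_ord0.
rewrite /cofactor !det_mx11 !mxE /= !e1 !e0 /= !(addn0, expr0, expr1).
by rewrite addr0; ring.
Qed.

Lemma char_poly_mx22 (F : comNzRingType) (A : 'M[F]_2) :
  char_poly A = 'X^2 - (A 0 0 + A 1 1)%:P * 'X
                + (A 0 0 * A 1 1 - A 0 1 * A 1 0)%:P.
Proof.
rewrite /char_poly det_mx2 !mxE /=.
by rewrite !(polyCD, polyCM, polyCN) /=; ring.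
Qed.

Section Spectrum.
Variable R : realType.

Lemma has_eigenvalues_mx22 (a b c d : R) (z1 z2 : R[i]) :
  z1 + z2 = (a + d)%:C -> z1 * z2 = (a * d - b * c)%:C ->
  has_eigenvalues (mx22 a b c d) [:: z1; z2].
Proof.
move=> zD zM; rewrite /has_eigenvalues char_poly_mx22 !big_cons big_nil !mxE /=.
rewrite -!(rmorphM, rmorphB, rmorphD) /= -zD -zM.
by rewrite !(polyCD, polyCM); ring.
Qed.

(** Split the characteristic equation at x + i y into real and imaginary parts. The discriminant
    condition forces y = 0; then negative trace and positive determinant exclude x >= 0, where every
    term of x^2 - t x + D is nonnegative and D is positive. *)
Lemma eigenvalue_mx22_lt0 (a b c d : R) (lam : R[i]) :
  a + d < 0 -> 0 < a * d - b * c ->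
  4 * (a * d - b * c) <= (a + d) ^+ 2 ->
  eigenvalue (cplx (mx22 a b c d)) lam -> lam < 0.
Proof.
move=> tr det disc; rewrite eigenvalue_root_char char_poly_mx22 !mxE /= rootE.
rewrite -!(rmorphM, rmorphB, rmorphD) /=.
rewrite !hornerE; case: lam => x y.
rewrite eq_complex /= => /andP[/eqP re /eqP im].
move: (a + d) (a * d - b * c) tr det disc re im => t D t0 D0 disc re im.
have y0 : y = 0.
  have /eqP : y * (2 * x - t) = 0 by rewrite -[RHS]im; ring.
  rewrite mulf_eq0 => /orP[/eqP //|/eqP xt].
  (* This is the real part times -4, after [t = 2 * x]; both summands are nonnegative, so [y]
     vanishes in this case too. *)
  have /eqP : 4 * y ^+ 2 + (t ^+ 2 - 4 * D) = 0.
    rewrite (_ : t = 2 * x); last by lra.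
    have : t = 2 * x by lra.
    move=> tx; rewrite tx in re; rewrite -[RHS](mulr0 (-4)) -[in RHS]re.
    by ring.
  have y2 : 0 <= 4 * y ^+ 2 by rewrite pmulr_rge0 // sqr_ge0.
  rewrite paddr_eq0 ?subr_ge0 //.
  by rewrite mulf_eq0 pnatr_eq0 /= expf_eq0 /= => /andP[/eqP].
rewrite ltcE /= y0 eqxx /= ltNge; apply/negP => x0.
suff : 0 < x ^+ 2 + (- t) * x + D.
  by rewrite (_ : _ + D = 0) ?ltxx // -[RHS]re y0; ring.
by rewrite ltr_wpDl // addr_ge0 ?sqr_ge0 // mulr_ge0 // oppr_ge0 ltW.
Qed.

End Spectrum.

(** * Spectrum of the mode matrices and multiplicity of the zero eigenvalue *)

Section CriticalModes.
Variable R : realType.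
Variables (f g : R * R -> R) (p : R * R) (L alpha Du Dv a b : R).
Hypotheses (df : differentiable f p) (dg : differentiable g p).
Local Notation fu := (partial_u f p).
Local Notation fv := (partial_v f p).
Local Notation gu := (partial_u g p).
Local Notation gv := (partial_v g p).
Hypotheses (alpha0 : 0 < alpha) (a0 : 0 < a) (b0 : 0 < b).
Hypothesis detE : 4 * a * b = fu * gv - fv * gu.
Hypothesis critE : fu * b + gv * a = 5 * a * b.
Hypothesis traceE : fu + alpha * gv = 0.
Hypothesis fvgu : fv * gu < 0.
Hypotheses (L0 : 0 < L).
Hypotheses (aE : a = Du * (pi / L) ^+ 2) (bE : b = Dv * (pi / L) ^+ 2).

Lemma mode_mxE n : mode_mx f g p L alpha Du Dv n =
  mx22 (fu - n%:R ^+ 2 * a) fv (alpha * gu) (alpha * (gv - n%:R ^+ 2 * b)).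
Proof. by rewrite /mode_mx aE bE; congr mx22; ring. Qed.

Definition critical_vector (m : R) : 'cV[R[i]]_2 :=
  \col_i (nth 0 [:: fv; m * a - fu] i)%:C.

Lemma critical_vector_neq0 m : critical_vector m != 0.
Proof.
have fv0 : fv != 0 by apply: contraTneq fvgu => ->; rewrite mul0r ltxx.
apply/eqP => /colP /(_ 0); rewrite !mxE /= => /eqP.
by rewrite eq_complex /= (negPf fv0).
Qed.

(** The first row annihilates the vector for every n; the second row gives [- alpha] times the
    expression in [mode_det]. *)
Lemma critical_vector_kernel n : (n%:R ^+ 2 - 1) * (n%:R ^+ 2 - 4) = 0 :> R ->
  cplx (mode_mx f g p L alpha Du Dv n) *m critical_vector (n%:R ^+ 2) = 0.
Proof.
move=> n14; have := mode_det detE critE (n%:R ^+ 2).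
rewrite -mulrA n14 mulr0 mode_mxE; move: (_ ^+ 2) => m mdet.
apply/colP => i; rewrite !mxE !big_ord_recl big_ord0 !mxE /=.
case: i => -[|[|//]] /= _; apply/eqP; rewrite eq_complex /=;
  apply/andP; split; apply/eqP; try ring.
transitivity (- alpha * ((fu - m * a) * (gv - m * b) - fv * gu)); first by ring.
by rewrite mdet mulr0.
Qed.

(** The shift [j.+1] makes the indices 0 and 1 stand for the modes 1 and 2. *)
Definition critical_mode (j : 'I_2) : R -> 'cV[R[i]]_2 :=
  cos_mode (j.+1%:R * pi / L) (critical_vector (j.+1%:R ^+ 2)).

Lemma critical_mode_zero (j : 'I_2) (x : R) :
  rd_linC f g alpha Du Dv p (critical_mode j) x = 0.
Proof.
rewrite /critical_mode rd_linC_cos_mode // critical_vector_kernel.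
  by rewrite /cos_mode scaler0.
by case: j => -[|[|//]] /= _; ring.
Qed.

(** The real and imaginary parts are brought to the shape of the right side in
    [critical_solution]. *)
Lemma critical_sumE (e : 'I_2 -> R[i]) x i :
  (\sum_(j < 2) e j *: critical_mode j x) i 0
  = let k1 := nth 0 [:: fv; a - fu] i in
    let k2 := nth 0 [:: fv; 4 * a - fu] i in
    let C1 := cos (pi / L * x) in let C2 := cos (2 * (pi / L) * x) in
    (k1 * (complex.Re (e 0) * C1) + k2 * (complex.Re (e 1) * C2))
    +i* (k1 * (complex.Im (e 0) * C1) + k2 * (complex.Im (e 1) * C2)).
Proof.
have e1 : lift ord0 ord0 = 1 :> 'I_2 by exact/val_inj.
rewrite !big_ord_recl big_ord0 !mxE !e1 /= mul1r expr1n mul1r.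
rewrite (_ : (1 %% 2).+1%:R * pi / L = 2 * (pi / L)); last by rewrite mulrA.
rewrite (_ : 2 ^+ 2 = 4 :> R); last by ring.
case: (e 0) => p0 q0; case: (e 1) => p1 q1 /=.
by apply/eqP; rewrite eq_complex /=; apply/andP; split; apply/eqP; ring.
Qed.

(** Induction on [k]: the image of [w] lies in the span of the critical modes by the induction
    hypothesis. As the operator is real, [critical_solution] applies to the real and imaginary parts
    of [w] separately and puts [w] in the same span. *)
Lemma gen_eigenfun_critical k (w : R -> 'cV[R[i]]_2) :
  gen_eigenfun f g p L alpha Du Dv 0 k w ->
  exists c : 'I_2 -> R[i],
    eq_on L w (fun x => \sum_(j < 2) c j *: critical_mode j x).
Proof.
elim: k w => [|k IH] w /=.
  move=> w0; exists (fun=> 0) => x xL; rewrite w0 // big1 // => j _.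
  by rewrite scale0r.
case=> dom [w' [Aw /IH[c w'E]]].
have s0 : pi / L != 0 by rewrite gt_eqF // divr_gt0 // pi_gt0.
have sL : sin (pi / L * L) = 0 by have := sin_mode 1 L0; rewrite mul1r.
have s2L : sin (2 * (pi / L) * L) = 0.
  by rewrite mulrA; exact: (sin_mode 2 L0).
have sol := critical_solution alpha0 a0 b0 detE critE traceE fvgu
  L0 s0 sL s2L aE bE.
have Cr i : C2_line (fun x => reals w x i 0) by case: (dom i).
have Ci i : C2_line (fun x => imags w x i 0) by case: (dom i).
have Nr i : neumann L (fun x => reals w x i 0) by case: (dom i).
have Ni i : neumann L (fun x => imags w x i 0) by case: (dom i).
have ode x : 0 <= x <= L -> rd_linC f g alpha Du Dv p w x
    = \sum_(j < 2) c j *: critical_mode j x.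
  by move=> xL; rewrite Aw // scale0r add0r w'E.
have [d1 [d2 rE]] : exists d1 d2 : R, forall x, 0 <= x <= L ->
    reals w x 0 0 = fv * (d1 * cos (pi / L * x) + d2 * cos (2 * (pi / L) * x))
    /\ reals w x 1 0 = (a - fu) * (d1 * cos (pi / L * x))
      + (4 * a - fu) * (d2 * cos (2 * (pi / L) * x)).
  apply: (sol _ _ (Cr 0) (Cr 1) (Nr 0) (Nr 1)
    (complex.Re (c 0)) (complex.Re (c 1))) => x xL.
  have /colP O := ode x xL; move: (O 0) (O 1).
  rewrite !critical_sumE [LHS]mxE [X in _ -> X = _ -> _]mxE.
  rewrite !rd_linE // ![col2 _ _ _ _]mxE /=.
  by case=> h1 _ [h2 _]; rewrite mulrDr; split.
have [e1 [e2 iE]] : exists d1 d2 : R, forall x, 0 <= x <= L ->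
    imags w x 0 0 = fv * (d1 * cos (pi / L * x) + d2 * cos (2 * (pi / L) * x))
    /\ imags w x 1 0 = (a - fu) * (d1 * cos (pi / L * x))
      + (4 * a - fu) * (d2 * cos (2 * (pi / L) * x)).
  apply: (sol _ _ (Ci 0) (Ci 1) (Ni 0) (Ni 1)
    (complex.Im (c 0)) (complex.Im (c 1))) => x xL.
  have /colP O := ode x xL; move: (O 0) (O 1).
  rewrite !critical_sumE [LHS]mxE [X in _ -> X = _ -> _]mxE.
  rewrite !rd_linE // ![col2 _ _ _ _]mxE /=.
  by case=> _ h1 [_ h2]; rewrite mulrDr; split.
exists (fun j => if j == 0 then d1 +i* e1 else d2 +i* e2) => x xL.
have wE i : w x i 0 = reals w x i 0 +i* imags w x i 0.
  by rewrite !mxE; case: (w x i 0).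
have [r0 r1] := rE x xL; have [i0 i1] := iE x xL.
apply/colP => i; rewrite critical_sumE wE.
have [->|->] : i = 0 \/ i = 1.
  by case: i => -[|[|//]] ?; [left|right]; exact/val_inj.
- by rewrite r0 i0 !mulrDr.
- by rewrite r1 i1.
Qed.

Lemma lin_multiplicity_critical : lin_multiplicity f g p L alpha Du Dv 0 2.
Proof.
exists critical_mode; split.
- move=> j; exists 1; split.
    exact/neumann_domain_cos_mode/sin_mode.
  exists (fun=> 0); split=> // x _.
  by rewrite critical_mode_zero scale0r addr0.
- move=> c c0.
  have fv0 : fv != 0 by apply: contraTneq fvgu => ->; rewrite mul0r ltxx.
  (* Independence follows from the first component at the two endpoints: the cosines of modes 1 and
     2 are 1, 1 at [x = 0] and -1, 1 at [x = L]. *)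
  have /colP/(_ 0) := c0 0 ltac:(by rewrite lexx ltW).
  rewrite critical_sumE mxE /= !mulr0 cos0 => -[r0 i0].
  have /colP/(_ 0) := c0 L ltac:(by rewrite lexx ltW).
  rewrite critical_sumE mxE /= -(mulrA 2) divfK ?gt_eqF //
    mulr_natl cos2pi cospi.
  move=> [rL iL].
  have z (s t : R) : fv * (s * 1) + fv * (t * 1) = 0 ->
      fv * (s * -1) + fv * (t * 1) = 0 -> s = 0 /\ t = 0.
    move=> h1 h2.
    by split; apply: (mulfI fv0); rewrite mulr0; lra.
  have [r0z r1z] := z _ _ r0 rL; have [i0z i1z] := z _ _ i0 iL.
  move=> j; have [->|->] : j = 0 \/ j = 1.
    by case: j => -[|[|//]] ?; [left|right]; exact/val_inj.
  + by move: r0z i0z; case: (c 0) => ? ? /= -> ->.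
  + by move: r1z i1z; case: (c 1) => ? ? /= -> ->.
- exact: gen_eigenfun_critical.
Qed.

(** The sign of [w] is left open, so that both conjugate eigenvalues are covered. *)
Lemma imaginary_eigenvalue (w : R) : w ^+ 2 = alpha * (fu * gv - fv * gu) ->
  lin_eigenvalue f g p L alpha Du Dv (0 +i* w).
Proof.
move=> w2.
have fv0 : fv != 0 by apply: contraTneq fvgu => ->; rewrite mul0r ltxx.
(* The eigenvector [(fv, - fu + i w)] solves the first row of the equation; the second row uses
   [traceE] and the value of [w ^+ 2]. *)
apply: (@cos_mode_eigenvalue _ f g L alpha Du Dv p 0
  (\col_i nth 0 [:: fv%:C; - fu +i* w] i)) => //.
  apply/eqP => /colP /(_ 0); rewrite !mxE /= => /eqP.
  by rewrite eq_complex /= (negPf fv0).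
rewrite mode_mxE; apply/colP => i.
have tE : alpha * gv = - fu by apply/eqP; rewrite -addr_eq0 addrC traceE.
have gE : alpha * gu * fv = - fu ^+ 2 - w ^+ 2.
  rewrite w2; transitivity (- fu ^+ 2 - alpha * gv * fu + alpha * gu * fv).
    by rewrite tE; ring.
  by ring.
rewrite !mxE !big_ord_recl big_ord0 !mxE /= !expr0n /= !mul0r !subr0.
case: i => -[|[|//]] /= _; apply/eqP; rewrite eq_complex /=;
  apply/andP; split; apply/eqP; rewrite ?tE ?gE; ring.
Qed.

Lemma mode0_eigenvalues (w : R) : w ^+ 2 = alpha * (fu * gv - fv * gu) ->
  has_eigenvalues (mode_mx f g p L alpha Du Dv 0) [:: 0 +i* w; 0 -i* w].
Proof.
move=> w2; rewrite mode_mxE; apply: has_eigenvalues_mx22.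
  by rewrite expr0n /= !mul0r !subr0 traceE; apply/eqP; rewrite eq_complex /=;
    apply/andP; split; apply/eqP; ring.
apply/eqP; rewrite eq_complex /= expr0n /=; apply/andP; split; apply/eqP;
  last by ring.
by transitivity (w ^+ 2); [ring|rewrite w2; ring].
Qed.

Lemma mode_trace (m : R) :
  (fu - m * a) + alpha * (gv - m * b) = - (m * (a + alpha * b)).
Proof.
transitivity ((fu + alpha * gv) - m * (a + alpha * b)); first by ring.
by rewrite traceE sub0r.
Qed.

Lemma mode_detE (m : R) :
  (fu - m * a) * (alpha * (gv - m * b)) - fv * (alpha * gu)
  = alpha * (a * b * (m - 1) * (m - 4)).
Proof. by rewrite -(mode_det detE critE); ring. Qed.

(** The determinant vanishes, so the remaining eigenvalue is the trace, negative by [mode_trace]. *)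
Lemma critical_mode_eigenvalues n : (0 < n)%N ->
  (n%:R ^+ 2 - 1) * (n%:R ^+ 2 - 4) = 0 :> R ->
  exists mu : R[i], mu < 0 /\
    has_eigenvalues (mode_mx f g p L alpha Du Dv n) [:: 0; mu].
Proof.
move=> n0 n14; exists (- (n%:R ^+ 2 * (a + alpha * b)))%:C; split.
  rewrite ltcE /= eqxx /= oppr_lt0 mulr_gt0 ?exprn_gt0 ?ltr0n //.
  by rewrite addr_gt0 // mulr_gt0.
rewrite mode_mxE; apply: has_eigenvalues_mx22.
  by rewrite add0r mode_trace.
by rewrite mode_detE -mulrA n14 !mulr0 mul0r.
Qed.

(** With m = n^2 >= 9 both (m - 1) and (m - 4) are positive, hence so is the determinant; the trace
    is negative and the discriminant is a sum of nonnegative terms. *)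
Lemma stable_mode n (lam : R[i]) : (3 <= n)%N ->
  eigenvalue (cplx (mode_mx f g p L alpha Du Dv n)) lam -> lam < 0.
Proof.
move=> n3; rewrite mode_mxE.
have m9 : 9 <= n%:R ^+ 2 :> R by rewrite
  -natrX ler_nat (leq_exp2r 3 n (isT : 0 < 2)%N).
move: (n%:R ^+ 2) m9 => m m9.
have ab0 : 0 < alpha * b by rewrite mulr_gt0.
apply: eigenvalue_mx22_lt0; rewrite ?mode_trace ?mode_detE.
- by rewrite oppr_lt0 mulr_gt0 ?addr_gt0 //; lra.
- by rewrite !mulr_gt0 // ?subr_gt0; lra.
rewrite -subr_ge0 (_ : _ - _ = m ^+ 2 * (a - alpha * b) ^+ 2
  + 4 * (alpha * a * b) * (5 * m - 4)); last by ring.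
have m54 : 0 <= 5 * m - 4 by lra.
have aab0 : 0 <= 4 * (alpha * a * b) by rewrite ltW // !mulr_gt0.
by apply: addr_ge0; apply: mulr_ge0 => //; exact: sqr_ge0.
Qed.

End CriticalModes.

(** * Assembly of the parameters and the spectral claims *)

Unset Implicit Arguments.

(* On R[i], z < 0 means that z is real and strictly negative. *)
Theorem proposition1 (R : realType) (f g : R * R -> R) (ub vb : R)
    (hf : C1_plane f) (hg : C1_plane g)
    (f0 : f (ub, vb) = 0) (g0 : g (ub, vb) = 0)
    (trM : \tr (kinetics_mx f g (ub, vb)) < 0)
    (detM : 0 < \det (kinetics_mx f g (ub, vb)))
    (fu_gt0 : 0 < partial_u f (ub, vb))
    (gv_lt0 : partial_v g (ub, vb) < 0) :
  forall L : R, 0 < L ->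
  exists alpha Du Dv : R,
    [/\ 0 < alpha, 0 < Du & 0 < Dv] /\
    exists omega : R, 0 < omega /\
      [/\ lin_eigenvalue f g (ub, vb) L alpha Du Dv (0 +i* omega),
          lin_eigenvalue f g (ub, vb) L alpha Du Dv (0 -i* omega),
          lin_eigenvalue f g (ub, vb) L alpha Du Dv 0
        & lin_multiplicity f g (ub, vb) L alpha Du Dv 0 2] /\
      [/\ has_eigenvalues (mode_mx f g (ub, vb) L alpha Du Dv 0)
            [:: 0 +i* omega; 0 -i* omega],
          exists mu1 : R[i], mu1 < 0 /\
            has_eigenvalues (mode_mx f g (ub, vb) L alpha Du Dv 1)
              [:: 0; mu1],
          exists mu2 : R[i], mu2 < 0 /\
            has_eigenvalues (mode_mx f g (ub, vb) L alpha Du Dv 2)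
              [:: 0; mu2]
        & forall n : nat, (3 <= n)%N -> forall lam : R[i],
            eigenvalue (cplx (mode_mx f g (ub, vb) L alpha Du Dv n)) lam ->
            lam < 0].
Proof.
move=> L L0; move: detM; rewrite det_mx2 !mxE /=.
set p := (ub, vb); set fu := partial_u f p in fu_gt0 *.
set gv := partial_v g p in gv_lt0 *.
set fv := partial_v f p; set gu := partial_u g p => det0.
have df : differentiable f p by case: hf.
have dg : differentiable g p by case: hg.
have gvn : gv != 0 by rewrite lt_eqF.
have fvgu : fv * gu < 0.
  have : fu * gv < 0 by rewrite pmulr_rlt0.
  lra.
have [a [b [a0 b0 detE critE]]] := turing_parameters fu_gt0 gv_lt0 det0.
have s0 : 0 < pi / L by rewrite divr_gt0 // pi_gt0.
have s20 : 0 < (pi / L) ^+ 2 by rewrite exprn_gt0.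
pose alpha := - fu / gv.
have alpha0 : 0 < alpha.
  by rewrite /alpha mulNr -mulrN -invrN divr_gt0 // oppr_gt0.
have traceE : fu + alpha * gv = 0 by rewrite /alpha divfK // subrr.
have aE : a = (a / (pi / L) ^+ 2) * (pi / L) ^+ 2 by rewrite divfK // gt_eqF.
have bE : b = (b / (pi / L) ^+ 2) * (pi / L) ^+ 2 by rewrite divfK // gt_eqF.
exists alpha, (a / (pi / L) ^+ 2), (b / (pi / L) ^+ 2); split.
  by split=> //; rewrite divr_gt0.
have ad0 : 0 < alpha * (fu * gv - fv * gu) by rewrite mulr_gt0.
(* The radicand is the determinant of the mode matrix for n = 0; since that matrix has trace 0, its
   eigenvalues are i times the two square roots of this number. *)
pose w := Num.sqrt (alpha * (fu * gv - fv * gu)).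
have w2 : w ^+ 2 = alpha * (fu * gv - fv * gu) by rewrite sqr_sqrtr // ltW.
have r1 : (1%:R ^+ 2 - 1) * (1%:R ^+ 2 - 4) = 0 :> R by ring.
have r2 : (2%:R ^+ 2 - 1) * (2%:R ^+ 2 - 4) = 0 :> R by ring.
exists w; split; first by rewrite sqrtr_gt0.
split; split.
- exact: (imaginary_eigenvalue df dg traceE fvgu L0 aE bE w2).
- apply: (imaginary_eigenvalue df dg traceE fvgu L0 aE bE).
  by rewrite sqrrN.
- apply: (@cos_mode_eigenvalue _ _ _ _ _ _ _ _ 1
    (critical_vector f p a (1%:R ^+ 2))) => //.
    exact: (critical_vector_neq0 a fvgu).
  by rewrite scale0r; exact: (critical_vector_kernel alpha detE critE aE bE r1).
- exact: (lin_multiplicity_critical df dg alpha0 a0 b0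
    detE critE traceE fvgu L0 aE bE).
- exact: (mode0_eigenvalues traceE aE bE w2).
- exact: (critical_mode_eigenvalues alpha0 a0 b0 detE critE traceE aE bE
    (ltn0Sn 0) r1).
- exact: (critical_mode_eigenvalues alpha0 a0 b0 detE critE traceE aE bE
    (ltn0Sn 1) r2).
- move=> n n3 lam.
  exact: (stable_mode alpha0 a0 b0 detE critE traceE aE bE n3).
Qed.
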